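(* Fix a constant $\Delta$ and let $\mathcal{G}$ be the family of all trees of maximum degree at most $\Delta$. Let $\Pi$ be an LCL problem on $\mathcal{G}$. If $\Pi$ is $T$-mendable for some function $T$ with $T(n) = o(n)$, then $\Pi$ is $T'$-mendable for some function $T'$ with $T'(n) = O(\log n)$. In other words, there is no LCL problem on trees whose mending radius is between $\omega(\log n)$ and $o(n)$.
   Context: A locally verifiable problem $\Pi$ on a graph family $\mathcal{G}$ is given by a set $\Sigma$ of input labels, a set $\Gamma$ of output labels and a verifier $\psi$ with verification radius $r\in\mathbb{N}$: for a graph $G=(V,E)\in\mathcal{G}$ with input labeling $\sigma:V\to\Sigma$, an output labeling $\lambda:V\to\Gamma$ and a node $v$, $\psi(G,\lambda,v)\in\{\text{happy},\text{unhappy}\}$ depends only on the radius-$r$ neighborhood of $v$ (its structure together with input and output labels, up to isomorphism). $\lambda$ is a solution if $\psi$ is happy at every node. $\Pi$ is an LCL problem if $\Sigma,\Gamma$ are finite and all graphs in $\mathcal{G}$ have maximum degree bounded by a constant. Partial labelings are maps $\lambda:V\to\Gamma\cup\{\bot\}$; the relaxed verifier $\psi^*$ is happy at $v$ if some node within distance $r$ of $v$ has label $\bot$, and otherwise $\psi^*(G,\lambda,v)=\psi(G,\lambda',v)$ for any $\lambda':V\to\Gamma$ agreeing with $\lambda$ on the radius-$r$ neighborhood of $v$; $\psi^*$ accepts $\lambda$ if it is happy at all nodes. Given $\lambda$ accepted by $\psi^*$ and a node $v$, a $t$-mend of $\lambda$ at $v$ is a partial labeling $\mu$ such that $\psi^*$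 accepts $\mu$, $\mu(v)\neq\bot$, $\mu(u)=\bot$ implies $\lambda(u)=\bot$, and $\mu(u)\neq\lambda(u)$ implies $u$ is within distance $t$ of $v$. For $T:\mathbb{N}\to\mathbb{N}$, a verifier $\psi$ is $T$-mendable if for every $G\in\mathcal{G}$ with $n$ nodes, every partial labeling $\lambda$ accepted by $\psi^*$ and every node $v$, a $T(n)$-mend of $\lambda$ at $v$ exists. The problem $\Pi$ is $T$-mendable if for some $r$ there is a radius-$r$ verifier for $\Pi$ (i.e., one accepting exactly the solutions of $\Pi$) that is $T$-mendable. *)

(* Defs.v *)
From mathcomp Require Import all_boot.
Set Implicit Arguments. Unset Strict Implicit. Unset Printing Implicit Defensive.

Fixpoint ball (V : finType) (G : rel V) (t : nat) (v : V) : {set V} :=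
  match t with
  | 0 => [set v]
  | t'.+1 => ball G t' v :|: [set y | [exists x in ball G t' v, G x y]]
  end.

Definition acyclic (V : finType) (G : rel V) : Prop :=
  forall p : seq V, uniq p -> 3 <= size p -> ~~ cycle G p.

Definition in_tree_family (Delta : nat) (V : finType) (G : rel V) : Prop :=
  [/\ symmetric G, irreflexive G,
      (forall x y : V, connect G x y), acyclic G &
      (forall x : V, #|[set y | G x y]| <= Delta)].

(* Type of verifiers: given a graph, input labeling, output labeling and node,
   return happy (true) / unhappy (false). *)
Definition verifier (Sigma Gamma : finType) :=
  forall (V : finType), rel V -> (V -> Sigma) -> (V -> Gamma) -> V -> bool.

Definition ball_iso (A Sigma : finType) (r : nat)
  (V : finType) (G : rel V) (sigma : V -> Sigma) (lam : V -> A) (v : V)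
  (V' : finType) (G' : rel V') (sigma' : V' -> Sigma) (lam' : V' -> A) (v' : V')
  : Prop :=
  exists f : V -> V',
    [/\ {in ball G r v &, injective f},
        f @: ball G r v = ball G' r v',
        f v = v',
        {in ball G r v &, forall x y, G' (f x) (f y) = G x y} &
        {in ball G r v, forall x, sigma' (f x) = sigma x /\ lam' (f x) = lam x}].

Definition local_verifier (Delta : nat) (Sigma Gamma : finType) (r : nat)
  (psi : verifier Sigma Gamma) : Prop :=
  forall (V : finType) (G : rel V) (sigma : V -> Sigma) (lam : V -> Gamma) (v : V)
         (V' : finType) (G' : rel V') (sigma' : V' -> Sigma) (lam' : V' -> Gamma) (v' : V'),
    in_tree_family Delta G -> in_tree_family Delta G' ->
    ball_iso r G sigma lam v G' sigma' lam' v' ->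
    psi V G sigma lam v = psi V' G' sigma' lam' v'.

Definition is_solution (Sigma Gamma : finType) (psi : verifier Sigma Gamma)
  (V : finType) (G : rel V) (sigma : V -> Sigma) (lam : V -> Gamma) : Prop :=
  forall v : V, psi V G sigma lam v.

(* Partial labelings: V -> option Gamma, None = bottom.
   Relaxed verifier psi^* at v. *)
Definition relaxed_happy (Sigma Gamma : finType) (r : nat) (psi : verifier Sigma Gamma)
  (V : finType) (G : rel V) (sigma : V -> Sigma) (lam : V -> option Gamma) (v : V) : Prop :=
  (exists u, u \in ball G r v /\ lam u = None) \/
  (forall lam' : V -> Gamma,
     (forall u, u \in ball G r v -> lam u = Some (lam' u)) -> psi V G sigma lam' v).

Definition relaxed_accepts (Sigma Gamma : finType) (r : nat) (psi : verifier Sigma Gamma)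
  (V : finType) (G : rel V) (sigma : V -> Sigma) (lam : V -> option Gamma) : Prop :=
  forall v : V, relaxed_happy r psi G sigma lam v.

Definition is_mend (Sigma Gamma : finType) (r : nat) (psi : verifier Sigma Gamma)
  (V : finType) (G : rel V) (sigma : V -> Sigma) (lam mu : V -> option Gamma)
  (v : V) (t : nat) : Prop :=
  [/\ relaxed_accepts r psi G sigma mu,
      mu v <> None,
      (forall u, mu u = None -> lam u = None) &
      (forall u, mu u <> lam u -> u \in ball G t v)].

Definition verifier_mendable (Delta : nat) (Sigma Gamma : finType) (r : nat)
  (psi : verifier Sigma Gamma) (T : nat -> nat) : Prop :=
  forall (V : finType) (G : rel V) (sigma : V -> Sigma) (lam : V -> option Gamma),
    in_tree_family Delta G ->
    relaxed_accepts r psi G sigma lam ->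
    forall v : V, exists mu : V -> option Gamma,
      is_mend r psi G sigma lam mu v (T #|V|).

(* The LCL problem Pi, given by its defining verifier psi0, is T-mendable:
   some radius-r verifier for Pi (accepting exactly Pi's solutions on the family)
   is T-mendable. *)
Definition problem_mendable (Delta : nat) (Sigma Gamma : finType)
  (psi0 : verifier Sigma Gamma) (T : nat -> nat) : Prop :=
  exists (r : nat) (psi : verifier Sigma Gamma),
    [/\ local_verifier Delta r psi,
        (forall (V : finType) (G : rel V) (sigma : V -> Sigma) (lam : V -> Gamma),
           in_tree_family Delta G ->
           (is_solution psi G sigma lam <-> is_solution psi0 G sigma lam)) &
        verifier_mendable Delta r psi T].

Definition little_o_n (T : nat -> nat) : Prop :=
  forall k : nat, 0 < k -> exists N : nat, forall n : nat, N <= n -> k * T n <= n.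

Definition big_O_log (T : nat -> nat) : Prop :=
  exists c N : nat, forall n : nat, N <= n -> T n <= c * trunc_log 2 n.

(* Main.v *)
Require Import Defs.
From mathcomp Require Import all_boot zify.
From mathcomp Require boolp.
Set Implicit Arguments. Unset Strict Implicit. Unset Printing Implicit Defensive.

(* The verifier and its radius [r] are kept; only its mending radius improves.

   Root the tree at the node to be mended.  Claim: below a node whose subtree has fewer than
   [2 ^ k] nodes, any accepted labeling [alpha] can be changed, within that subtree, into one
   that agrees with the given labeling [lam] at depth more than [k * l] ([l] a constant).
   Follow the heavy path for [l] steps.  The side trees have at most half the size and are
   handled recursively, so it suffices to find a labeling equal to [alpha] above the path and
   to [lam] below it, with no constraint in the side trees.  By the pigeonhole principle two
   cuts of the path have the same surroundings and admit the same label windows when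
   everything above is labeled by [alpha], resp. by [lam].  The segment between them can
   therefore be repeated [2 m] times.  In the pumped tree, put an extension of [alpha] on the
   upper half, an extension of [lam] on the lower half, and a hole at the node in the middle.
   A hole separates the two halves, so this is accepted; the pumped tree has size linear in
   [m], so for large [m] the [o(n)]-mend of the hole does not reach the ends.  As repeating
   the segment does not change the admissible windows, the mended labeling can be pulled back
   to the original tree. *)

(** * Balls and isomorphisms between them *)

Lemma ball_step (V : finType) (G : rel V) t v x y :
  x \in ball G t v -> G x y -> y \in ball G t.+1 v.
Proof.
by move=> xB Gxy /=; rewrite !inE; apply/orP; right; apply/existsP; exists x; rewrite xB.
Qed.

Lemma ball_inv (V : finType) (G : rel V) t v y :
  y \in ball G t.+1 v ->
  y \in ball G t v \/ exists2 x, x \in ball G t v & G x y.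
Proof.
by rewrite /= !inE => /orP[|/existsP[x /andP[xB Gxy]]]; [left | right; exists x].
Qed.

Lemma ball_center (V : finType) (G : rel V) t v : v \in ball G t v.
Proof. by elim: t => [|t IH] /=; rewrite !inE ?IH. Qed.

Lemma ball_mono (V : finType) (G : rel V) t t' v :
  t <= t' -> {subset ball G t v <= ball G t' v}.
Proof.
move=> /subnK <-; elim: (t' - t) => // k IH x xB.
by rewrite addSn /= inE IH.
Qed.

Section BallIso.
Variables (A Sigma : finType) (r : nat).

Lemma rel_ball (V V' : finType) (G : rel V) (G' : rel V') v v' (P : V -> V' -> bool) :
  P v v' ->
  (forall x y x' y', P x y -> P x' y' -> G' y y' = G x x') ->
  (forall t x y x', t < r -> x \in ball G t v -> P x y -> G x x' ->
     exists y', P x' y') ->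
  forall t x, t <= r -> x \in ball G t v -> exists2 y, y \in ball G' t v' & P x y.
Proof.
move=> Pv adjP step; elim=> [|t IH] x le_tr.
  by rewrite inE => /eqP ->; exists v'; rewrite ?inE.
case/ball_inv=> [xB|[z zB Gzx]].
  have [y yB Pxy] := IH x (ltnW le_tr) xB.
  by exists y => //; rewrite /= inE yB.
have [y yB Pzy] := IH z (ltnW le_tr) zB.
have [y' Pxy'] := step t z y x le_tr zB Pzy Gzx.
by exists y' => //; apply: ball_step yB _; rewrite (adjP _ _ _ _ Pzy Pxy').
Qed.

(** The isomorphism is given as a partial injective relation [P], so no map off the ball has to be
    specified. The two step conditions let [P] find partners as the balls grow, in either graph. *)
Lemma ball_iso_of_rel (V V' : finType) (G : rel V) (G' : rel V')
    (sg : V -> Sigma) (lam : V -> A) v (sg' : V' -> Sigma) (lam' : V' -> A) v'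
    (P : V -> V' -> bool) :
  (forall x y y', P x y -> P x y' -> y = y') ->
  (forall x x' y, P x y -> P x' y -> x = x') ->
  P v v' ->
  (forall x y x' y', P x y -> P x' y' -> G' y y' = G x x') ->
  (forall t x y x', t < r -> x \in ball G t v -> P x y -> G x x' ->
     exists y', P x' y') ->
  (forall t x y y', t < r -> y \in ball G' t v' -> P x y -> G' y y' ->
     exists x', P x' y') ->
  (forall x y, x \in ball G r v -> P x y -> sg' y = sg x /\ lam' y = lam x) ->
  ball_iso r G sg lam v G' sg' lam' v'.
Proof.
move=> Pfun Pinj Pv adjP step step' labP.
pose f x := odflt v' [pick y | P x y].
have fE x y : P x y -> f x = y.
  move=> Pxy; rewrite /f; case: pickP => [z Pxz|/(_ y)]; last by rewrite Pxy.
  exact: Pfun Pxz Pxy.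
have fwd x : x \in ball G r v -> exists2 y, y \in ball G' r v' & P x y.
  by apply: (rel_ball Pv adjP step).
have bwd y : y \in ball G' r v' -> exists2 x, x \in ball G r v & P x y.
  apply: (rel_ball (P := fun y x => P x y) Pv) => //.
    by move=> a b c d Pab Pcd; rewrite (adjP _ _ _ _ Pab Pcd).
  move=> t a b c lt_tr aB Pba Gac; exact: step' lt_tr aB Pba Gac.
exists f; split.
- move=> x x' /fwd[y _ Pxy] /fwd[y' _ Pxy'].
  by rewrite (fE _ _ Pxy) (fE _ _ Pxy') => eyy; apply: Pinj Pxy _; rewrite eyy.
- apply/setP => y; apply/imsetP/idP.
    by case=> x /fwd[z zB Pxz] ->; rewrite (fE _ _ Pxz).
  by case/bwd => x xB Pxy; exists x => //; rewrite (fE _ _ Pxy).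
- exact: fE.
- move=> x x' /fwd[y _ Pxy] /fwd[y' _ Pxy'].
  by rewrite (fE _ _ Pxy) (fE _ _ Pxy'); apply: adjP.
- by move=> x xB; have [y _ Pxy] := fwd x xB; rewrite (fE _ _ Pxy); apply: labP.
Qed.

End BallIso.

Section Relaxed.
Variables (Delta : nat) (Sigma Gamma : finType) (r : nat) (psi : verifier Sigma Gamma).

Lemma relaxed_happy_iso (psi_local : local_verifier Delta r psi)
    (V V' : finType) (G : rel V) (G' : rel V') sg lam v sg' lam' v' :
  in_tree_family Delta G -> in_tree_family Delta G' ->
  ball_iso r G sg lam v G' sg' lam' v' ->
  relaxed_happy r psi G sg lam v -> relaxed_happy r psi G' sg' lam' v'.
Proof.
move=> fG fG' [f [injf imf fv adjf labf]] [[u [uB lu]]|hap].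
  left; exists (f u); split; first by rewrite -imf imset_f.
  by rewrite (labf u uB).2.
right=> mu Hmu.
have iso : ball_iso r G sg (mu \o f) v G' sg' mu v'.
  by exists f; split=> // x xB; split=> //; rewrite (labf x xB).1.
rewrite -(psi_local _ _ _ _ _ _ _ _ _ _ fG fG' iso).
by apply: hap => u uB; rewrite -(labf u uB).2 Hmu // -imf imset_f.
Qed.

Lemma relaxed_happy_ext (V : finType) (G : rel V) sg lam lam' v :
  (forall u, u \in ball G r v -> lam u = lam' u) ->
  relaxed_happy r psi G sg lam v -> relaxed_happy r psi G sg lam' v.
Proof.
move=> E [[u [uB lu]]|hap]; [left|right=> mu Hmu].
  by exists u; rewrite -E.
by apply: hap => u uB; rewrite E // Hmu.
Qed.

End Relaxed.

(** * Words as tree nodes *)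

Lemma suffix_cat_size (A : eqType) (a b c d : seq A) :
  a ++ b = c ++ d -> size d <= size b -> suffix d b.
Proof.
move=> e le; have le' : size a <= size c.
  by have := congr1 size e; rewrite !size_cat; lia.
have -> : b = drop (size a) (a ++ b) by rewrite drop_size_cat.
rewrite e drop_cat; case: ltngtP le' => // [_ _|-> _]; first exact: suffix_suffix.
by rewrite subnn drop0 suffix_refl.
Qed.

Section Words.
Variable A : eqType.
Implicit Types (p q x y z a b c : seq A) (s : seq (seq A)).

Definition strip q p := take (size p - size q) p.

Lemma strip_cat q z : strip q (z ++ q) = z.
Proof. by rewrite /strip size_cat addnK take_size_cat. Qed.

Lemma catr_inj q z z' : z ++ q = z' ++ q -> z = z'.
Proof. by move/(congr1 (strip q)); rewrite !strip_cat. Qed.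

(* The children of the node [p] are the words [i :: p]: ancestors are suffixes. *)
Definition adj p q := (behead q == p) && (q != [::]) || (behead p == q) && (p != [::]).

Lemma adjP p q : reflect (exists i, q = i :: p \/ p = i :: q) (adj p q).
Proof.
apply: (iffP orP) => [[]|[i []] ->]; last 2 first.
- by left; rewrite eqxx.
- by right; rewrite eqxx.
- by case: q => [|i q] /andP[/eqP /= e //]; exists i; left; rewrite e.
- by case: p => [|i p] /andP[/eqP /= e //]; exists i; right; rewrite e.
Qed.

Lemma adj_sym : symmetric adj.
Proof. by move=> p q; rewrite /adj orbC. Qed.

Lemma adj_cat x y b : adj (x ++ b) (y ++ b) = adj x y.
Proof.
apply/adjP/adjP => -[i [] e]; exists i.
- left; move: e; case: y => [|j y] /=; last by case=> -> /catr_inj ->.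
  by move=> /(congr1 size) /eqP; rewrite /= size_cat -addSn -[X in X == _]add0n eqn_add2r.
- right; move: e; case: x => [|j x] /=; last by case=> -> /catr_inj ->.
  by move=> /(congr1 size) /eqP; rewrite /= size_cat -addSn -[X in X == _]add0n eqn_add2r.
- by left; rewrite e.
- by right; rewrite e.
Qed.

(* Distance at most [t] in the tree of all words; [c] is a common ancestor. *)
Definition near t x y := exists a b c, [/\ x = a ++ c, y = b ++ c & size a + size b <= t].

Lemma near_refl t x : near t x x.
Proof. by exists [::], [::], x. Qed.

Lemma near_mono t t' x y : t <= t' -> near t x y -> near t' x y.
Proof. by move=> le_tt [a [b [c [-> -> le]]]]; exists a, b, c; split=> //; apply: leq_trans le le_tt. Qed.

Lemma near_step t x y z : near t x y -> adj y z -> near t.+1 x z.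
Proof.
case=> a [b [c [-> -> le]]] /adjP[i [->|]].
  by exists a, (i :: b), c; split=> //=; rewrite addnS.
case: b le => [|j b] le /= e.
  exists (rcons a i), [::], z; split=> //; first by rewrite e cat_rcons.
  by rewrite size_rcons addn0 ltnS (leq_trans (leq_addr _ _) le).
case: e => _ <-; exists a, b, c; split=> //.
by apply: leq_trans (leq_trans le (leqnSn _)); rewrite leq_add2l leqnSn.
Qed.

Lemma near_cat t x y b : near t (x ++ b) (y ++ b) -> near t x y.
Proof.
case=> a [d [c [ea ed le]]].
have [lb|lb] := leqP (size b) (size c).
  have /suffixP[c' ec] := suffix_cat_size (esym ea) lb.
  by move: ea ed; rewrite ec !catA => /catr_inj -> /catr_inj ->; exists a, d, c'.
(* The common ancestor [c] is shorter than [b], so the part of the path above [b] is cut short at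
   the empty word. *)
exists x, y, [::]; rewrite !cats0; split=> //; apply: leq_trans le.
move: (congr1 size ea) (congr1 size ed); rewrite !size_cat => ha hd.
apply: leq_add; rewrite -(leq_add2r (size b)).
  by rewrite ha leq_add2l ltnW.
by rewrite hd leq_add2l ltnW.
Qed.

Lemma suffix_adj q p p' : adj p p' -> suffix q p' -> ~~ suffix q p -> p' = q.
Proof.
move=> /adjP[i [->|->]] /suffixP[z e].
  by case: z e => [|j z] //= [_ ->]; rewrite suffix_suffix.
by rewrite e -cat_cons suffix_suffix.
Qed.

End Words.

Section Trees.
Variables (A : finType) (Delta : nat).
Implicit Types (p q z : seq A) (s : seq (seq A)).

Definition tgraph s : rel (seq_sub s) := fun x y => adj (val x) (val y).

(** The summand [p != [::]] counts the edge to the parent. *)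
Definition wf s :=
  [/\ [::] \in s, (forall i p, i :: p \in s -> p \in s) &
      forall p, p \in s -> (p != [::]) + #|[set i | i :: p \in s]| <= Delta].

Lemma wf_suffix s z p : wf s -> z ++ p \in s -> p \in s.
Proof. by case=> _ cl _; elim: z => //= i z IH /cl. Qed.

Lemma wf_tree s : wf s -> in_tree_family Delta (@tgraph s).
Proof.
case=> root cl deg.
have sym : symmetric (@tgraph s) by move=> x y; rewrite /tgraph adj_sym.
split=> //.
- move=> x; apply/adjP => -[i e]; have {e} : val x = i :: val x by case: e.
  by move=> /(congr1 size)/eqP; rewrite /= -[X in X == _]add0n -add1n eqn_add2r.
- have toroot p (ps : p \in s) : connect (@tgraph s) (SeqSub root) (SeqSub ps).
    elim: p ps => [|i p IH] ps; first by rewrite (bool_irrelevance ps root) connect0.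
    apply: connect_trans (IH (cl _ _ ps)) _; apply: connect1.
    by apply/adjP; exists i; left.
  move=> [x xs] [y ys]; apply: connect_trans (toroot y ys).
  by rewrite sym_connect_sym.
- move=> p Up sz; apply/negP => cyc.
  (* Both cycle neighbors of a deepest node [x] of the cycle would have to be its parent. *)
  have [x xp xmax] : exists2 x, x \in p & forall y, y \in p -> size (val y) <= size (val x).
    case: p sz {Up cyc} => // x0 p _.
    case: (@arg_maxnP _ x0 (fun x => x \in x0 :: p) (fun x => size (val x))) => [|x xp xm].
      exact: mem_head.
    by exists x.
  have [i p' rotp] := rot_to xp.
  have sz' : size p' >= 2 by move: sz; rewrite -(size_rot i) rotp.
  move: cyc Up; rewrite -(rot_cycle i) -(rot_uniq i) rotp.
  have sub y : y \in p' -> size (val y) <= size (val x).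
    by move=> yp; apply: xmax; rewrite -(mem_rot i) rotp inE yp orbT.
  case: p' sz' {rotp} sub => // a1 p'; elim/last_ind: p' => // p' b1 _ _ sub.
  have par y : y \in a1 :: rcons p' b1 -> tgraph x y -> val y = behead (val x).
    move=> /sub le /adjP[j [e|-> //]]; move: le.
    by rewrite e /= ltnn.
  rewrite /= rcons_path last_rcons => /and3P[xa _ bx] /andP[_ /andP[/negP ab _]].
  apply: ab; rewrite mem_rcons inE; apply/orP; left; apply/eqP/val_inj.
  rewrite (par a1) ?mem_head // (par b1) //; first by rewrite inE mem_rcons mem_head orbT.
  by rewrite sym.
- move=> x; apply: leq_trans (deg _ (valP x)).
  (* [h] sends a child to its letter and the parent to [None], so the neighbors inject into the
     children plus at most one extra value. *)
  pose h (y : seq_sub s) :=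
    if val y is i :: p then (if p == val x then Some i else None) else None.
  have hS y i : h y = Some i -> val y = i :: val x.
    by rewrite /h; case: (val y) => // j p; case: eqP => // -> [->].
  have hN y : tgraph x y -> h y = None -> exists j, val x = j :: val y.
    by rewrite /h => /adjP[j [->|e]]; [rewrite eqxx | exists j].
  have inj : {in [set y | tgraph x y] &, injective h}.
    move=> y y'; rewrite !inE => xy xy'; case ey: (h y) => [i|] /esym ey'; apply: val_inj.
      by rewrite (hS _ _ ey) (hS _ _ ey').
    have [j e] := hN _ xy ey; have [j' e'] := hN _ xy' ey'.
    by move: e; rewrite e' => -[].
  rewrite -(card_in_imset inj).
  pose C := [set i | i :: val x \in s].
  pose N := if val x == [::] then set0 else [set None : option A].
  apply: (@leq_trans #|N :|: Some @: C|).
    apply: subset_leq_card; apply/subsetP => o /imsetP[y]; rewrite inE => xy ->.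
    rewrite inE; case ey: (h y) => [i|].
      by rewrite mem_imset ?inE; [rewrite -(hS _ _ ey) (valP y) orbT | move=> ? ? []].
    by have [j e] := hN _ xy ey; rewrite /N e inE.
  apply: leq_trans (leq_card_setU _ _).1 _.
  apply: leq_add; last by apply: leq_imset_card.
  by rewrite /N; case: eqP => _; rewrite ?cards0 ?cards1.
Qed.

Lemma ball_near s t (x y : seq_sub s) : y \in ball (@tgraph s) t x -> near t (val x) (val y).
Proof.
elim: t y => [|t IH] y; first by rewrite inE => /eqP ->; apply: near_refl.
case/ball_inv => [/IH|[z /IH nz zy]]; first exact: near_mono.
exact: near_step nz zy.
Qed.

End Trees.

(** The topmost node [c] of the path is shorter than [q], so the descent from [c] to [y] passes
    through [q]. *)
Lemma near_below (A : finType) t (p q y : seq A) : near t p y -> ~~ suffix q p -> suffix q y ->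
  exists2 z, y = z ++ q & size z <= t.
Proof.
case=> a [b [c [-> -> le]]] npq /suffixP[z e]; exists z => //.
have lt : size c < size q.
  rewrite ltnNge; apply: contra npq => /(suffix_cat_size e); exact: suffix_catr.
have h : size b + size c = size z + size q by rewrite -!size_cat e.
apply: leq_trans (leq_trans (leq_addl (size a) _) le).
by rewrite -(leq_add2r (size q)) -h leq_add2l ltnW.
Qed.

(** * Grafting *)

Definition graft (A : finType) T (q1 q2 : seq A) (f1 f2 : seq A -> T) p :=
  if suffix q1 p then f2 (strip q1 p ++ q2) else f1 p.

(** A property rather than an equation with [graft], because one tree is viewed as a graft in
    several ways: the original tree, for instance, as a graft that takes its lower part from a
    pumped tree. *)
Definition is_graft (A : finType) T (q1 q2 : seq A) (f1 f2 f : seq A -> T) :=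
  (forall p, ~~ suffix q1 p -> f p = f1 p) /\ (forall z, f (z ++ q1) = f2 (z ++ q2)).

Lemma graftP (A : finType) T q1 q2 f1 f2 : is_graft q1 q2 f1 f2 (@graft A T q1 q2 f1 f2).
Proof.
by split=> [p|z]; rewrite /graft; [move=> /negPf ->|rewrite suffix_suffix strip_cat].
Qed.

Section Happy.
Variables (A : finType) (Delta : nat) (Sigma Gamma : finType) (r : nat).
Variable psi : verifier Sigma Gamma.
Hypothesis psi_local : local_verifier Delta r psi.

(* The boolean of a node tells whether its output label is allowed to be missing. *)
Definition tree := (seq (seq A) * (seq A -> Sigma * bool))%type.
Definition labeling := seq A -> option Gamma.
Implicit Types (st : tree) (lam : labeling) (p q y z : seq A).

Definition cell st lam p := (p \in st.1, st.2 p, lam p).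

(** Quantifying over [x] makes the condition vacuous at words that are not nodes, so it can be
    stated for all words. *)
Definition happy st lam p := forall x : seq_sub st.1, val x = p ->
  relaxed_happy r psi (@tgraph A st.1) (fun x => (st.2 (val x)).1) (fun x => lam (val x)) x.

(** Balls are compared relative to base nodes [b1] and [b2], and only words above these bases are
    matched. This is enough if the bases are the roots or if the center is at least [r] below them,
    as the ball then does not climb past the base. *)
Lemma happy_shift st1 lam1 b1 st2 lam2 b2 x0 :
  wf Delta st1.1 -> wf Delta st2.1 ->
  (b1 = [::] /\ b2 = [::]) \/ r <= size x0 ->
  (forall y, near r x0 y -> cell st1 lam1 (y ++ b1) = cell st2 lam2 (y ++ b2)) ->
  happy st1 lam1 (x0 ++ b1) -> happy st2 lam2 (x0 ++ b2).
Proof.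
case: st1 => s1 i1; case: st2 => s2 i2.
rewrite /happy /cell /= => w1 w2 hb H hap1 x2 ex2.
have x1s : x0 ++ b1 \in s1.
  by have [-> _ _] := H x0 (near_refl _ _); rewrite -ex2 (valP x2).
apply: (relaxed_happy_iso psi_local (wf_tree w1) (wf_tree w2)) (hap1 (SeqSub x1s) erefl).
pose P (x : seq_sub s1) (y : seq_sub s2) :=
  boolp.asbool (exists z, val x = z ++ b1 /\ val y = z ++ b2).
have step (s s' : seq (seq A)) b b' t z (v x x' : seq_sub s) : t < r ->
    b = [::] /\ b' = [::] \/ r <= size x0 ->
    (forall y, near r x0 y -> y ++ b \in s -> y ++ b' \in s') ->
    val v = x0 ++ b -> x \in ball (@tgraph A s) t v ->
    val x = z ++ b -> tgraph x x' ->
    exists z' (y' : seq_sub s'), val x' = z' ++ b /\ val y' = z' ++ b'.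
  move=> lt_tr hb' mem ev xB ex xx'.
  have n1 : near t x0 z.
    by apply: (@near_cat _ _ _ _ b); rewrite -ev -ex; apply: ball_near xB.
  have [z' ez] : exists z', val x' = z' ++ b.
    case/adjP: xx' => i [->|e]; first by exists (i :: z); rewrite ex.
    move: e; rewrite ex; case: (z) n1 => [|j z1] n1 /=; last by case=> _ <-; exists z1.
    (* Here [x'] would be the parent of the base; reaching the base from [x0] already takes
       [size x0 >= r] steps, more than the [t < r] available. *)
    case: hb' => [[-> _] //|le].
    case: n1 => a [d [c [ea ed le']]].
    have c0 : c = [::] by case: d ed {le'} => //; case: c {ea}.
    move: ea; rewrite c0 cats0 => ea; move: (leq_ltn_trans (leq_trans (leq_addr _ _) le') lt_tr).
    by rewrite -ea ltnNge le.
  have ys : z' ++ b' \in s'.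
    apply: mem; last by rewrite -ez; apply: valP.
    apply: near_mono lt_tr _; apply: near_step n1 _.
    by rewrite -(adj_cat _ _ b) -ex -ez.
  by exists z', (SeqSub ys).
apply: (@ball_iso_of_rel _ _ _ _ _ _ _ _ _ _ _ _ _ P).
- move=> x y y' /boolp.asboolP[z [e1 e2]] /boolp.asboolP[z' [e1' e2']].
  by apply: val_inj; rewrite e2 e2'; congr (_ ++ _); apply: (@catr_inj _ b1); rewrite -e1 -e1'.
- move=> x x' y /boolp.asboolP[z [e1 e2]] /boolp.asboolP[z' [e1' e2']].
  by apply: val_inj; rewrite e1 e1'; congr (_ ++ _); apply: (@catr_inj _ b2); rewrite -e2 -e2'.
- by apply/boolp.asboolP; exists x0.
- move=> x y x' y' /boolp.asboolP[z [e1 e2]] /boolp.asboolP[z' [e1' e2']].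
  by rewrite /tgraph e1 e2 e1' e2' !adj_cat.
- move=> t x y x' lt_tr xB /boolp.asboolP[z [e1 e2]] xx'.
  have mem u : near r x0 u -> u ++ b1 \in s1 -> u ++ b2 \in s2 by move=> /H [->].
  have [z' [y' [ez ey]]] := step s1 s2 b1 b2 t z (SeqSub x1s) x x' lt_tr hb mem erefl xB e1 xx'.
  by exists y'; apply/boolp.asboolP; exists z'.
- move=> t x y y' lt_tr yB /boolp.asboolP[z [e1 e2]] yy'.
  have mem u : near r x0 u -> u ++ b2 \in s2 -> u ++ b1 \in s1 by move=> /H [->].
  have hb' : (b2 = [::] /\ b1 = [::]) \/ r <= size x0.
    by case: hb => [[-> ->]|]; [left|right].
  have [z' [x' [ey ex]]] := step s2 s1 b2 b1 t z x2 y y' lt_tr hb' mem ex2 yB e2 yy'.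
  by exists x'; apply/boolp.asboolP; exists z'.
- move=> x y xB /boolp.asboolP[z [e1 e2]].
  have n1 : near r x0 z.
    by apply: (@near_cat _ _ _ _ b1); rewrite -e1; apply: (ball_near xB).
  by have [_ h1 h2] := H z n1; rewrite e1 e2 h1 h2.
Qed.

(* The window at [q] starts at the ancestor [drop r q] of [q] and has depth [2 * r], so that it
   contains the [r]-ball of [q]. *)
Definition window (T : finType) (f : seq A -> T) q : {ffun (2 * r).-bseq A -> T} :=
  [ffun y : (2 * r).-bseq A => f (y ++ drop r q)].

Lemma windowE (T : finType) (f f' : seq A -> T) q q' : window f q = window f' q' <->
  forall y, size y <= 2 * r -> f (y ++ drop r q) = f' (y ++ drop r q').
Proof.
split=> [e y sy|e]; last by apply/ffunP => y; rewrite !ffunE e // size_bseq.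
by move/ffunP: e => /(_ (Bseq sy)); rewrite !ffunE.
Qed.

(** The flag [p == q] marks the node in its window, so that equal profiles force the same letters
    between the node and the base of its window. *)
Definition profile st q := window (fun p => (p \in st.1, st.2 p, p == q)) q.

Lemma profile_take st1 q1 st2 q2 : profile st1 q1 = profile st2 q2 ->
  r <= size q1 -> r <= size q2 -> take r q1 = take r q2.
Proof.
move=> /windowE e s1 s2; have /e [_ _] : size (take r q1) <= 2 * r.
  by rewrite size_takel // mul2n -addnn leq_addr.
rewrite cat_take_drop eqxx => /esym/eqP e'.
by apply: (@catr_inj _ (drop r q2)); rewrite e' cat_take_drop.
Qed.

(** Both cut nodes are reached from their window bases by the same letters. Hence what is grafted
    into the window has the same relative place in both trees, where the two windows agree. *)
Lemma graft_window T (f1 f2 f : seq A -> T) q1 q2 : take r q1 = take r q2 ->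
  is_graft q1 q2 f1 f2 f ->
  (forall y, size y <= 2 * r -> f1 (y ++ drop r q1) = f2 (y ++ drop r q2)) ->
  forall y, size y <= 2 * r -> f (y ++ drop r q1) = f1 (y ++ drop r q1).
Proof.
move=> etake [g1 g2] eW y sy.
case: (boolP (suffix q1 (y ++ drop r q1))) => [/suffixP[z e]|]; last exact: g1.
have ey : y = z ++ take r q1.
  by apply: (@catr_inj _ (drop r q1)); rewrite e -catA cat_take_drop.
by rewrite eW // e g2 ey -catA etake cat_take_drop.
Qed.

Lemma profile_graft st1 st2 st q1 q2 : r <= size q1 -> r <= size q2 ->
  profile st1 q1 = profile st2 q2 ->
  is_graft q1 q2 (fun p => (p \in st1.1, st1.2 p)) (fun p => (p \in st2.1, st2.2 p))
    (fun p => (p \in st.1, st.2 p)) ->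
  profile st q1 = profile st1 q1.
Proof.
move=> s1 s2 e [g1 g2]; apply/windowE.
pose f st q p := (p \in st.1, st.2 p, p == q) : bool * (Sigma * bool) * bool.
apply: (@graft_window _ (f st1 q1) (f st2 q2) (f st q1) _ _ (profile_take e s1 s2)); last exact/windowE.
split=> [p np|z]; congr (_, _); [exact: g1 | exact: g2 |].
by apply/eqP/eqP => /(@catr_inj _ _ z [::]) ->.
Qed.

(** A ball centered outside the subtree of [q1] reaches at most [r] below [q1], where the window
    still agrees with [st1]. A ball centered inside it climbs at most [r] above [q1]; if it leaves
    the subtree, it does so within the window, which also agrees with [st2]. *)
Lemma happy_graft st1 st2 st lam1 lam2 lam q1 q2 :
  wf Delta st1.1 -> wf Delta st2.1 -> wf Delta st.1 ->
  r <= size q1 -> r <= size q2 ->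
  profile st1 q1 = profile st2 q2 -> window lam1 q1 = window lam2 q2 ->
  is_graft q1 q2 (cell st1 lam1) (cell st2 lam2) (cell st lam) ->
  (forall p, ~~ suffix q1 p -> happy st1 lam1 p -> happy st lam p) /\
  (forall z, happy st2 lam2 (z ++ q2) -> happy st lam (z ++ q1)).
Proof.
move=> w1 w2 w s1 s2 esh /windowE elam [g1 g2].
have etake := profile_take esh s1 s2; move/windowE: esh => esh.
have eW y : size y <= 2 * r -> cell st1 lam1 (y ++ drop r q1) = cell st2 lam2 (y ++ drop r q2).
  by move=> sy; rewrite /cell; have [-> -> _] := esh y sy; rewrite elam.
have eq1 : q1 = take r q1 ++ drop r q1 by rewrite cat_take_drop.
have eq2 : q2 = take r q1 ++ drop r q2 by rewrite etake cat_take_drop.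
have stk : size (take r q1) = r by rewrite size_takel.
have eN := graft_window etake (conj g1 g2) eW.
split=> [p np|z].
  have := @happy_shift st1 lam1 [::] st lam [::] p w1 w; rewrite !cats0; apply; first by left.
  move=> y ny; rewrite !cats0.
  case: (boolP (suffix q1 y)) => [qy|]; last by move/g1.
  have [z ez sz] := near_below ny np qy.
  have -> : y = (z ++ take r q1) ++ drop r q1 by rewrite -catA -eq1.
  by rewrite eN // size_cat stk mul2n -addnn leq_add2r.
have -> : z ++ q2 = (z ++ take r q1) ++ drop r q2 by rewrite -catA -eq2.
have -> : z ++ q1 = (z ++ take r q1) ++ drop r q1 by rewrite -catA -eq1.
apply: happy_shift => //; first by right; rewrite size_cat stk leq_addl.
move=> y [a [b [c [ea -> le]]]].
(* If the common ancestor is at or below the cut, so is [y]; otherwise [y] is at depth at most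
   [2 * r] below the base and lies in the window. *)
have [le_c|lt_c] := leqP r (size c).
  have /suffixP[c' ->] : suffix (take r q1) c by apply: (suffix_cat_size (esym ea)); rewrite stk.
  by rewrite -!catA -eq1 -eq2 !catA g2.
have sy : size (b ++ c) <= 2 * r.
  rewrite size_cat mul2n -addnn leq_add //; last exact: ltnW.
  exact: leq_trans (leq_addl _ _) le.
by rewrite eN // eW.
Qed.

End Happy.

Section Grafting.
Variables (A : finType) (Delta : nat) (Sigma : finType).
Notation tree := (tree A Sigma).
Implicit Types (st : tree) (p q y z u : seq A).

Definition site st p := (p \in st.1, st.2 p).

Definition tree_graft q1 q2 st1 st2 : tree :=
  ([seq p <- st1.1 | ~~ suffix q1 p] ++ [seq strip q2 p ++ q1 | p <- st2.1 & suffix q2 p],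
   graft q1 q2 st1.2 st2.2).

Lemma tree_graftP q1 q2 st1 st2 :
  is_graft q1 q2 (site st1) (site st2) (site (tree_graft q1 q2 st1 st2)).
Proof.
have [g1 g2] := graftP q1 q2 st1.2 st2.2.
have E p : (p \in (tree_graft q1 q2 st1 st2).1) = (~~ suffix q1 p) && (p \in st1.1) ||
    (p \in [seq strip q2 p ++ q1 | p <- st2.1 & suffix q2 p]).
  by rewrite mem_cat mem_filter.
split=> [p np|z]; rewrite /site E [_.2 _]/= ?g2.
  rewrite g1 // np /= orb_idr // => /mapP[p' _ e].
  by rewrite e suffix_suffix in np.
rewrite suffix_suffix /=; congr (_, _); apply/mapP/idP => [[p']|zs].
  rewrite mem_filter => /andP[/suffixP[z' ->]]; rewrite strip_cat => zs /catr_inj ->.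
  exact: zs.
by exists (z ++ q2); rewrite ?strip_cat // mem_filter suffix_suffix.
Qed.

Lemma size_tree_graft q1 q2 st1 st2 :
  size (tree_graft q1 q2 st1 st2).1 <= size st1.1 + size st2.1.
Proof.
rewrite size_cat size_map; apply: leq_add; rewrite size_filter; exact: count_size.
Qed.

(** Every node keeps the degree that it has in the tree it comes from: [q1] remains a child of its
    parent, and both cut nodes are nonempty, so each has a parent to count. *)
Lemma wf_graft q1 q2 st1 st2 st :
  wf Delta st1.1 -> wf Delta st2.1 -> q1 \in st1.1 -> q2 \in st2.1 ->
  q1 != [::] -> q2 != [::] -> is_graft q1 q2 (site st1) (site st2) (site st) ->
  wf Delta st.1.
Proof.
move=> [r1 c1 d1] [r2 c2 d2] q1s q2s n1 n2 [g1 g2].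
have m1 p : ~~ suffix q1 p -> (p \in st.1) = (p \in st1.1) by move/g1 => -[].
have m2 z : (z ++ q1 \in st.1) = (z ++ q2 \in st2.1) by case: (g2 z).
have child i p : ~~ suffix q1 p -> (i :: p \in st.1) = (i :: p \in st1.1).
  move=> np; case: (boolP (suffix q1 (i :: p))) => [sp|/m1 //].
  have -> : i :: p = q1 by apply: suffix_adj sp np; apply/adjP; exists i; left.
  by rewrite q1s -[q1]cat0s m2.
split.
- by rewrite m1 // suffixs0.
- move=> i p; case: (boolP (suffix q1 p)) => [/suffixP[z ->]|np].
    by rewrite -cat_cons !m2; apply: c2.
  by rewrite child // m1 //; apply: c1.
- move=> p; case: (boolP (suffix q1 p)) => [/suffixP[z ->]|np].
    rewrite m2 => /d2; have -> : (z ++ q2 != [::]) = (z ++ q1 != [::]).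
      by case: z => //=; rewrite n1 n2.
    by congr (_ + _ <= _); apply: eq_card => i; rewrite !inE -!cat_cons m2.
  rewrite m1 // => /d1.
  by congr (_ + _ <= _); apply: eq_card => i; rewrite !inE child.
Qed.

End Grafting.

Lemma suffix_cat2 (A : eqType) (q y z : seq A) : suffix (y ++ q) (z ++ q) = suffix y z.
Proof.
apply/suffixP/suffixP => -[x]; last by move=> ->; exists x; rewrite catA.
by rewrite catA => /catr_inj ->; exists x.
Qed.

Lemma drop_catl (A : Type) n (y q : seq A) : n <= size y -> drop n (y ++ q) = drop n y ++ q.
Proof.
rewrite drop_cat; case: ltngtP => // -> _.
by rewrite subnn drop0 drop_size.
Qed.

Lemma suffix_antisym (A : eqType) (p q : seq A) : suffix p q -> suffix q p -> p = q.
Proof.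
move=> /suffixP[a ->] /suffixP[b e].
have : size b + size a = 0.
  by have := congr1 size e; rewrite !size_cat; lia.
by case: a {e} => //= ? ?; rewrite addnS.
Qed.

(** * Pumping a path *)

Section Pumping.
Variables (A : finType) (Delta : nat) (Sigma Gamma : finType) (r : nat).
Variable psi : verifier Sigma Gamma.
Hypothesis psi_local : local_verifier Delta r psi.
Notation tree := (tree A Sigma).
Notation labeling := (labeling A Gamma).
Notation happy := (happy r psi).
Implicit Types (st t : tree) (p q y z u : seq A) (lam : labeling).

(** Strict, so that changes below [u] preserve the label of [u]; at the root this keeps the label
    obtained by the first mend. *)
Definition sbelow u p := suffix u p && (p != u).

Lemma sbelow_trans u q p : sbelow u q -> suffix q p -> sbelow u p.
Proof.
move=> /andP[uq nuq] qp; rewrite /sbelow (suffix_trans uq qp) /=.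
by apply: contra nuq => /eqP e; rewrite -e in uq *; apply/eqP; apply: suffix_antisym.
Qed.

Definition accepted st lam := forall p, happy st lam p.

(** Storing the permission in the tree, next to the input label, makes it part of the profiles and
    copies it along when the tree is pumped. *)
Definition holes_ok st lam := forall p, p \in st.1 -> lam p = None -> (st.2 p).2.

(* The label windows at [q] reachable when [gam] is kept outside of the subtree of [u]; the
   verifier is only consulted at nodes not below [q]. *)
Definition above (gam : labeling) u st q w := exists lam : labeling,
  [/\ forall p, ~~ suffix q p -> happy st lam p,
      forall p, ~~ sbelow u p -> lam p = gam p,
      forall p, p \in st.1 -> ~~ suffix q p -> lam p = None -> (st.2 p).2 &
      window r lam q = w].

Lemma cell_graft q1 q2 st1 st2 st lam1 lam2 :
  is_graft q1 q2 (site st1) (site st2) (site st) ->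
  is_graft q1 q2 (cell st1 lam1) (cell st2 lam2) (cell st (graft q1 q2 lam1 lam2)).
Proof.
case=> g1 g2; have [l1 l2] := graftP q1 q2 lam1 lam2.
split=> [p /[dup] /g1 [e1 e2] np|z]; first by rewrite /cell e1 e2 l1.
by have [e1 e2] := g2 z; rewrite /cell e1 e2 l2.
Qed.

Section Extend.
Variables (gam : labeling) (u q1 q2 : seq A) (st1 st2 st : tree) (lam2 : labeling).
Hypotheses (w1 : wf Delta st1.1) (w2 : wf Delta st2.1) (w : wf Delta st.1).
Hypotheses (s1 : r <= size q1) (s2 : r <= size q2).
Hypothesis sh : profile r st1 q1 = profile r st2 q2.
Hypothesis gr : is_graft q1 q2 (site st1) (site st2) (site st).
Hypothesis uq : sbelow u q1.
Hypothesis ab : above gam u st1 q1 (window r lam2 q2).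

(** A labeling realizing the window at [q1] is continued by [lam2]. The condition [r <= size y] puts
    the base of the new window at or below [q1], so that this window is read from [lam2] alone. *)
Lemma above_step y : r <= size y ->
  (forall p, ~~ suffix (y ++ q2) p -> happy st2 lam2 p) ->
  (forall p, p \in st2.1 -> ~~ suffix (y ++ q2) p -> lam2 p = None -> (st2.2 p).2) ->
  above gam u st (y ++ q1) (window r lam2 (y ++ q2)).
Proof.
move=> sy hap2 mk2; case: ab => lam1 [hap1 top1 mk1 wi].
have [h1 h2] := happy_graft psi_local w1 w2 w s1 s2 sh wi (cell_graft lam1 lam2 gr).
have [l1 l2] := graftP q1 q2 lam1 lam2; have [g1 g2] := gr.
exists (graft q1 q2 lam1 lam2); split.
- move=> p; case: (boolP (suffix q1 p)) => [/suffixP[z ->]|np _]; last by apply: h1 => //; apply: hap1.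
  by rewrite suffix_cat2 => ny; apply: h2; apply: hap2; rewrite suffix_cat2.
- move=> p nu; rewrite l1 ?top1 //; apply: contra nu; exact: sbelow_trans.
- move=> p; case: (boolP (suffix q1 p)) => [/suffixP[z ->]|np].
    by have [-> ->] := g2 z; rewrite suffix_cat2 l2 => zs ny; apply: mk2; rewrite ?suffix_cat2.
  by have [-> ->] := g1 p np; rewrite l1 // => ps _; apply: mk1.
- by apply/windowE => v _; rewrite !drop_catl // !catA l2.
Qed.

(** Turns an admissible window into a labeling of the whole tree, following [lam2] from the cut
    downwards. *)
Lemma above_complete : accepted st2 lam2 -> holes_ok st2 lam2 ->
  exists lam, [/\ accepted st lam, holes_ok st lam,
    forall p, ~~ sbelow u p -> lam p = gam p & forall z, lam (z ++ q1) = lam2 (z ++ q2)].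
Proof.
move=> hap2 mk2; case: ab => lam1 [hap1 top1 mk1 wi].
have [h1 h2] := happy_graft psi_local w1 w2 w s1 s2 sh wi (cell_graft lam1 lam2 gr).
have [l1 l2] := graftP q1 q2 lam1 lam2; have [g1 g2] := gr.
exists (graft q1 q2 lam1 lam2); split=> //.
- move=> p; case: (boolP (suffix q1 p)) => [/suffixP[z ->]|np]; last by apply: h1 => //; apply: hap1.
  by apply: h2; apply: hap2.
- move=> p; case: (boolP (suffix q1 p)) => [/suffixP[z ->]|np].
    by have [-> ->] := g2 z; rewrite l2; apply: mk2.
  by have [-> ->] := g1 p np; rewrite l1 // => ps; apply: mk1.
- move=> p nu; rewrite l1 ?top1 //; apply: contra nu; exact: sbelow_trans.
Qed.

End Extend.

Lemma above_self gam u st q : accepted st gam -> holes_ok st gam ->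
  above gam u st q (window r gam q).
Proof. by move=> h m; exists gam; split=> // p ps _; apply: m. Qed.

(** The only edge into the subtree of [c] ends at [c]. A ball that contains [c] sees a hole; any
    other ball is connected and stays on one side, where it sees only [lamA] or only [lamB]. *)
Lemma accepted_mix st lamA lamB c :
  c \in st.1 -> accepted st lamA -> accepted st lamB ->
  accepted st (fun p => if p == c then None else if suffix c p then lamB p else lamA p).
Proof.
move=> cs hA hB p x ex; set xc := SeqSub cs.
case: (boolP (xc \in ball (@tgraph A st.1) r x)) => [cB|ncB].
  by left; exists xc; rewrite eqxx.
have side n (x' : seq_sub st.1) : n <= r -> x' \in ball (@tgraph A st.1) n x ->
    suffix c (val x') = suffix c p.
  elim: n x' => [|n IH] y le; first by rewrite inE => /eqP ->; rewrite ex.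
  case/ball_inv => [|[z zB zy]]; first exact: IH (ltnW le).
  rewrite -(IH z (ltnW le) zB).
  have yB := ball_mono le (ball_step zB zy); have zB' := ball_mono (ltnW le) zB.
  have nc (w : seq_sub st.1) : w \in ball (@tgraph A st.1) r x -> val w <> c.
    by move=> wB e; case/negP: ncB; rewrite (_ : xc = w) //; apply: val_inj.
  have yz : adj (val y) (val z) by rewrite adj_sym.
  case: (boolP (suffix c (val y))) (boolP (suffix c (val z))) => [sy|sy] [sz|sz] //.
    by case: (nc y yB); apply: suffix_adj zy sy sz.
  by case: (nc z zB'); apply: suffix_adj yz sz sy.
have nc (y : seq_sub st.1) : y \in ball (@tgraph A st.1) r x -> val y == c = false.
  by move=> yB; apply/eqP => e; case/negP: ncB; rewrite (_ : xc = y) //; apply: val_inj.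
case: (boolP (suffix c p)) => cp.
  apply: relaxed_happy_ext (hB p x ex) => y yB.
  by rewrite nc // (side r) // cp.
apply: relaxed_happy_ext (hA p x ex) => y yB.
by rewrite nc // (side r) // (negPf cp).
Qed.

Lemma mend_words T st lam p : verifier_mendable Delta r psi T ->
  wf Delta st.1 -> accepted st lam -> p \in st.1 ->
  exists mu : labeling, [/\ accepted st mu, mu p <> None,
    forall p', mu p' = None -> lam p' = None &
    forall p', mu p' <> lam p' -> near (T #|{: seq_sub st.1}|) p p'].
Proof.
move=> mend w acc ps.
have [|mu [h1 h2 h3 h4]] := mend _ _ (fun x : seq_sub st.1 => (st.2 (val x)).1)
  (fun x => lam (val x)) (wf_tree w) _ (SeqSub ps).
  by move=> x; apply: acc.
pose mu' p' := if insub p' is Some x then mu x else lam p'.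
have muE (x : seq_sub st.1) : mu' (val x) = mu x by rewrite /mu' valK.
exists mu'; split.
- by move=> p' x _; apply: relaxed_happy_ext (h1 x) => y _; rewrite muE.
- by rewrite -[p]/(val (SeqSub ps)) muE.
- by move=> p'; rewrite /mu'; case: insubP => [x _ <-|] //; apply: h3.
- by move=> p'; rewrite {1}/mu'; case: insubP => [x _ <-|] // /h4 /ball_near.
Qed.

Lemma card_seq_sub_le (B : choiceType) (s : seq B) : #|{: seq_sub s}| <= size s.
Proof.
rewrite cardE -(size_map val) uniq_leq_size ?(map_inj_uniq val_inj) ?enum_uniq //.
by move=> _ /mapP[x _ ->]; apply: valP.
Qed.

(** With [S] the size of the list of nodes of a tree, [(m + m).+1 * S] bounds the size after pumping
    [m + m] times. For large [n], [4 * S * T n <= n] gives [T n <= (2 m + 1) / 4 < m]; the finitely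
    many small [n] are handled by taking [m] above a maximum. *)
Lemma little_o_bound T S : little_o_n T -> 0 < S ->
  exists2 m, 0 < m & forall n, n <= (m + m).+1 * S -> T n < m.
Proof.
move=> oT S0; have [N HN] := oT (4 * S) ltac:(by rewrite muln_gt0).
pose M := \max_(n < N) T n; exists M.+1 => // n le.
have [lt|ge] := ltnP n N.
  by rewrite ltnS; apply: (@leq_bigmax _ (fun n : 'I_N => T n) (Ordinal lt)).
have h := leq_trans (HN n ge) le.
rewrite -(ltn_pmul2l (_ : 0 < 4 * S)) ?muln_gt0 //; apply: leq_ltn_trans h _.
by nia.
Qed.

Section Pump.
Variables (t : tree) (q y u : seq A).
Hypotheses (wt : wf Delta t.1) (qN : q != [::]) (rq : r <= size q).
Hypotheses (yqt : y ++ q \in t.1) (ry : r < size y).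
Hypotheses (sh : profile r t (y ++ q) = profile r t q) (uq : sbelow u q).

(* [tip k] is the lower end of the path after the insertion of [k] copies of the segment [y];
   requiring [r < size y] puts the base of each window inside the preceding copy. *)
Definition tip k := iter k (cat y) q.

(** What is grafted is the subtree of [q], not of [y ++ q]: it brings one more segment followed by
    the old continuation. The first step reproduces [t], so [pump k] has [k] segments between [q]
    and [tip k], and for [0 < k] continues below [tip k] as [t] does below [y ++ q]. *)
Fixpoint pump k : tree :=
  if k is k'.+1 then tree_graft (tip k') q (pump k') t else t.

Lemma tip_add j k : exists2 z, tip (j + k) = z ++ tip k & size z = j * size y.
Proof.
elim: j => [|j [z e sz]]; first by exists [::].
by exists (y ++ z); rewrite ?size_cat ?sz // addSn /= -/(tip _) e catA.
Qed.

Lemma suffix_tip k : suffix q (tip k).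
Proof. by have [z] := tip_add k 0; rewrite addn0 => -> _; apply: suffix_suffix. Qed.

Lemma size_tip k : r <= size (tip k).
Proof. by apply: leq_trans rq _; apply: size_suffix (suffix_tip k). Qed.

Lemma tip_neq0 k : tip k != [::].
Proof. by case: (tip k) (suffix_tip k) => //; rewrite suffixs0 (negPf qN). Qed.

Lemma sbelow_tip k : sbelow u (tip k).
Proof. exact: sbelow_trans uq (suffix_tip k). Qed.

Lemma size_pump k : size (pump k).1 <= k.+1 * size t.1.
Proof.
elim: k => [|k IH] /=; first by rewrite mul1n.
apply: leq_trans (size_tree_graft _ _ _ _) _.
by rewrite [k.+2 * _]mulSn addnC leq_add2l.
Qed.

(** The window at [tip k.+1] lies in the newly grafted part, a copy of the one at [y ++ q]; by [sh]
    its profile is again that of [q], which allows the next graft. *)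
Lemma pump_inv k :
  [/\ wf Delta (pump k).1, tip k \in (pump k).1 & profile r (pump k) (tip k) = profile r t q].
Proof.
have qt : q \in t.1 by exact: wf_suffix wt yqt.
elim: k => [|k [wk mk sk]] //=.
have [g1 g2] := tree_graftP (tip k) q (pump k) t.
split; first exact: wf_graft wk wt mk qt (tip_neq0 k) qN (tree_graftP _ _ _ _).
  by have [-> _] := g2 y.
rewrite -sh; apply/windowE => v _; rewrite !drop_catl 1?ltnW // !catA.
by congr (_, _); [exact: g2 (v ++ drop r y) | apply/eqP/eqP => /catr_inj ->].
Qed.

Lemma pump_wf k : wf Delta (pump k).1. Proof. by case: (pump_inv k). Qed.
Lemma pump_tip k : tip k \in (pump k).1. Proof. by case: (pump_inv k). Qed.
Lemma pump_profile k : profile r (pump k) (tip k) = profile r t q. Proof. by case: (pump_inv k). Qed.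

(** The segment transforms the admissible windows at its upper end into those at its lower end, in
    the same way in [t] and in the pumped tree. Since it maps the set at [q] to itself, all copies
    leave this set unchanged. *)
Lemma pump_above gam : (forall w, above gam u t q w <-> above gam u t (y ++ q) w) ->
  forall k w, above gam u (pump k) (tip k) w <-> above gam u t q w.
Proof.
move=> eqab; elim=> [|k IH] // w; rewrite eqab.
have gr := tree_graftP (tip k) q (pump k) t.
(* Read backwards, [t] is the graft at [q] of what [pump k.+1] has below [tip k], so labelings can
   be carried back. *)
have gr' : is_graft q (tip k) (site t) (site (pump k.+1)) (site t).
  by split=> // z; rewrite (gr.2 z).
split=> -[lam [hap top mk <-]].
(* Above [tip k] the two pumped trees coincide and their windows there agree, so happiness of the
   same [lam] passes from [pump k.+1] to [pump k]. *)
- have gr0 : is_graft (tip k) (tip k) (site (pump k.+1)) (site (pump k)) (site (pump k)).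
    by split=> // p np; rewrite (gr.1 p np).
  have sh0 : profile r (pump k.+1) (tip k) = profile r (pump k) (tip k).
    exact: profile_graft (size_tip k) rq (pump_profile k) gr.
  have [h _] := happy_graft psi_local (pump_wf k.+1) (pump_wf k) (pump_wf k)
    (size_tip k) (size_tip k) sh0 (erefl (window r lam (tip k)))
    (conj (fun p np => congr1 (fun c => (c, lam p)) (gr0.1 p np)) (fun z => erefl)).
  have up p : ~~ suffix (tip k) p -> ~~ suffix (tip k.+1) p.
    by apply: contra; apply: suffix_trans; apply: suffix_suffix.
  have ab : above gam u t q (window r lam (tip k)).
    rewrite -IH; exists lam; split=> // p.
      by move=> np; apply: h => //; apply: hap; apply: up.
    have := mk p; set st := pump k.+1 => mkp ps np.
    have e1 : (p \in st.1) = (p \in (pump k).1) := congr1 fst (gr.1 p np).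
    have e2 : st.2 p = (pump k).2 p := congr1 snd (gr.1 p np).
    by rewrite -e2; apply: mkp; rewrite ?e1 // up.
  apply: (above_step wt (pump_wf k.+1) wt rq (size_tip k) _ gr' uq ab (ltnW ry)) => //.
  by rewrite sh0 pump_profile.
- have ab : above gam u (pump k) (tip k) (window r lam q).
    rewrite IH; exists lam; split=> // p.
      move=> np; apply: hap; apply: contra np; apply: suffix_trans; exact: suffix_suffix.
    move=> ps np; apply: mk => //; apply: contra np; apply: suffix_trans; exact: suffix_suffix.
  exact: (above_step (pump_wf k) wt (pump_wf k.+1) (size_tip k) rq (pump_profile k) gr
    (sbelow_tip k) ab (ltnW ry)).
Qed.

Lemma spine_mend T (alpha lam : labeling) :
  verifier_mendable Delta r psi T -> little_o_n T ->
  accepted t alpha -> holes_ok t alpha -> accepted t lam -> holes_ok t lam ->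
  (forall gam, gam = alpha \/ gam = lam ->
     forall w, above gam u t q w <-> above gam u t (y ++ q) w) ->
  exists mu : labeling, [/\ accepted t mu, holes_ok t mu,
    forall p, ~~ sbelow u p -> mu p = alpha p &
    forall z, mu (z ++ y ++ q) = lam (z ++ y ++ q)].
Proof.
move=> mend oT accA okA accL okL eqab.
have [|m m0 Tm] := little_o_bound oT (_ : 0 < size t.1).
  by case: wt; case: (t.1).
have ryq : r <= size (y ++ q) by rewrite size_cat (leq_trans rq) ?leq_addl.
pose k := m + m.
(* This needs at least one copy, hence [m0]. *)
have grk : is_graft (tip k) (y ++ q) (site (pump k)) (site t) (site (pump k)).
  split=> // z; rewrite /k; case: (m) m0 => // j _; rewrite addSn [tip _]/= !catA.
  exact: (tree_graftP (tip (j + j.+1)) q (pump (j + j.+1)) t).2 (z ++ y).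
(* The window of [gam] at [y ++ q] is admissible at [tip k] as well; below [tip k] the extension
   follows [gam] itself. *)
have extend gam : gam = alpha \/ gam = lam -> accepted t gam -> holes_ok t gam ->
    exists L : labeling, [/\ accepted (pump k) L, holes_ok (pump k) L,
      forall p, ~~ sbelow u p -> L p = gam p & forall z, L (z ++ tip k) = gam (z ++ y ++ q)].
  move=> hg acc ok.
  apply: (above_complete (pump_wf k) wt (pump_wf k) (size_tip k) ryq _ grk (sbelow_tip k) _ acc ok).
    by rewrite pump_profile sh.
  by apply/pump_above; [exact: eqab | apply/eqab => //; apply: above_self].
have [LA [accLA okLA topA _]] := extend alpha (or_introl erefl) accA okA.
have [LB [accLB okLB _ botB]] := extend lam (or_intror erefl) accL okL.
have [Y eY sY] := tip_add m m; have [Y' eY' sY'] := tip_add m 0.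
rewrite addn0 in eY'.
have le_m : m <= size Y by rewrite sY leq_pmulr //; apply: leq_ltn_trans ry.
have le_m' : m <= size Y' by rewrite sY'; rewrite -sY.
have mk : tip m \in (pump k).1.
  by apply: (@wf_suffix _ Delta _ Y _ (pump_wf k)); rewrite -eY pump_tip.
have [mu [accM nM holeM nearM]] := mend_words mend (pump_wf k) (accepted_mix mk accLA accLB) mk.
have small : T #|{: seq_sub (pump k).1}| < m.
  exact/Tm/(leq_trans (card_seq_sub_le _))/size_pump.
have okM : holes_ok (pump k) mu.
  move=> p ps np; have := holeM p np; case: eqP => [e|_]; first by rewrite e in np.
  by case: ifP => _; [apply: okLB | apply: okLA].
(* From the hole at [tip m], leaving the subtree of [q] takes at least [m] upward steps, more than
   the mending radius. *)
have topM p : ~~ suffix q p -> mu p = LA p.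
  move=> np; have nm : suffix (tip m) p = false.
    by apply: contraNF np; apply: suffix_trans (suffix_tip m).
  have -> : LA p = if p == tip m then None else if suffix (tip m) p then LB p else LA p.
    by rewrite nm; case: eqP nm => // ->; rewrite suffix_refl.
  apply: boolp.contrapT => /nearM [a [b [c [ea eb le]]]].
  have lt_c : size c < size q.
    rewrite ltnNge; apply: contra np => le_c; rewrite eb; apply: suffix_catr.
    by apply: (@suffix_cat_size _ a c Y' q) => //; rewrite -ea.
  have : m <= size a.
    apply: leq_trans le_m' _; rewrite -(leq_add2r (size q)) -size_cat -eY' ea size_cat leq_add2l.
    exact: ltnW.
  by rewrite leqNgt (leq_ltn_trans _ small) // (leq_trans (leq_addr _ _) le).
(* Symmetrically, reaching [tip k] or below takes at least [m] downward steps. *)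
have botM z : mu (z ++ tip k) = lam (z ++ y ++ q).
  rewrite -botB.
  have sm : suffix (tip m) (z ++ tip k) by rewrite /k eY catA suffix_suffix.
  have sz : size (z ++ tip k) = size z + size Y + size (tip m).
    by rewrite /k eY !size_cat addnA.
  have -> : LB (z ++ tip k) = if z ++ tip k == tip m then None
      else if suffix (tip m) (z ++ tip k) then LB (z ++ tip k) else LA (z ++ tip k).
    by rewrite sm; case: eqP sz => // -> /eqP; rewrite -[X in X == _]add0n eqn_add2r; lia.
  apply: boolp.contrapT => /nearM [a [b [c [ea eb le]]]].
  have : m <= size b.
    have := congr1 size ea; have := sz; rewrite eb !size_cat => h1 h2.
    have h3 : size c <= size (tip m) by rewrite h2 leq_addl.
    apply: leq_trans le_m _; rewrite -(leq_add2r (size (tip m))).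
    apply: leq_trans (leq_add (leqnn (size b)) h3).
    by rewrite h1 leq_add2r leq_addl.
  by rewrite leqNgt (leq_ltn_trans _ small) // (leq_trans (leq_addl _ _) le).
(* The mended labeling equals [alpha] at the top, so its window at [tip k] is admissible for
   [alpha]; by [pump_above] the same window is admissible at [y ++ q] in [t]. *)
have ab : above alpha u t (y ++ q) (window r mu (tip k)).
  apply/eqab; first by left.
  apply/(pump_above (eqab _ (or_introl erefl)) k); exists mu; split=> //.
  - move=> p nu; rewrite topM ?topA //.
    by apply: contra nu; apply: sbelow_trans.
  - by move=> p ps _; apply: okM.
have grt : is_graft (y ++ q) (tip k) (site t) (site (pump k)) (site t).
  by split=> // z; rewrite (grk.2 z).
have [|mu0 [h1 h2 h3 h4]] := above_complete wt (pump_wf k) wt ryq (size_tip k) _ grt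
  (sbelow_trans uq (suffix_suffix y q)) ab accM okM.
  by rewrite pump_profile.
by exists mu0; split=> // z; rewrite h4 botM.
Qed.
End Pump.
End Pumping.

(** * Mending along heavy paths *)

Section Heavy.
Variables (A : finType) (Delta : nat).
Implicit Types (p q y z u : seq A) (s : seq (seq A)).

Lemma child_suffix u p : suffix u p -> p != u -> exists i, suffix (i :: u) p.
Proof.
case/suffixP => z ->; elim/last_ind: z => [|z i _]; first by rewrite eqxx.
by rewrite cat_rcons => _; exists i; apply: suffix_suffix.
Qed.

Lemma child_suffix_inj i j u p : suffix (i :: u) p -> suffix (j :: u) p -> i = j.
Proof.
move=> /suffixP[z ->] /suffixP[z']; rewrite -!cat_rcons => /catr_inj /eqP.
by rewrite eqseq_rcons => /andP[_ /eqP].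
Qed.

Lemma count_children s u i j : u \in s -> i != j ->
  count (suffix (i :: u)) s + count (suffix (j :: u)) s < count (suffix u) s.
Proof.
move=> us nij; have : 0 < count (pred1 u) s by rewrite -has_count has_pred1.
suff : count (suffix (i :: u)) s + count (suffix (j :: u)) s + count (pred1 u) s
    <= count (suffix u) s.
  by move=> le pos; apply: leq_trans le; rewrite -[X in X < _]addn0 ltn_add2l.
elim: s {us} => //= p s IH.
suff le : suffix (i :: u) p + suffix (j :: u) p + (p == u) <= suffix u p.
  by rewrite (addnACA (suffix _ p)) addnACA leq_add.
have sub a : suffix (a :: u) p -> suffix u p.
  by apply: suffix_trans; rewrite -cat1s suffix_suffix.
have neq a : suffix (a :: u) p -> p == u = false.
  by move=> /size_suffix /= le; apply/eqP => e; rewrite e ltnn in le.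
case: (boolP (suffix (i :: u) p)) => [si|_].
  rewrite (neq _ si) (sub _ si); case: (boolP (suffix (j :: u) p)) => // sj.
  by rewrite (child_suffix_inj si sj) eqxx in nij.
case: (boolP (suffix (j :: u) p)) => [sj|_]; first by rewrite (neq _ sj) (sub _ sj).
by case: eqP => // ->; rewrite suffix_refl.
Qed.

(** [y] is the heavy path and [C] lists the roots of its side trees. The third alternative is
    restricted to paths of full length, since a shorter one ends at a leaf. *)
Lemma heavy_path s k l u : wf Delta s -> u \in s -> count (suffix u) s < 2 ^ k.+1 ->
  exists y (C : seq (seq A)), [/\ size y <= l, y ++ u \in s,
    forall c, c \in C ->
      [/\ c \in s, suffix u c, size c <= size u + l & count (suffix c) s < 2 ^ k] &
    forall p, p \in s -> suffix u p ->
      [\/ size p <= size u + l, exists2 c, c \in C & suffix c p |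
          size y = l /\ suffix (y ++ u) p]].
Proof.
move=> w; elim: l u => [|l IH] u us cu.
  by exists [::], [::]; split=> // p _ up; apply: Or33.
have cl i p : suffix (i :: u) p -> p \in s -> i :: u \in s.
  by case/suffixP => z -> /(wf_suffix w).
case: (pickP (fun i => i :: u \in s)) => [i0 i0s|nochild]; last first.
  exists [::], [::]; split=> // p ps up; apply: Or31.
  have [->|/(child_suffix up)[i /cl /(_ ps)]] := eqVneq p u; first by rewrite leq_addr.
  by rewrite nochild.
case: (@arg_maxnP _ i0 (fun i => i :: u \in s) (fun i => count (suffix (i :: u)) s) i0s).
move=> h hs hmax.
have ch : count (suffix (h :: u)) s < 2 ^ k.+1.
  apply: leq_ltn_trans cu; apply: sub_count => p.
  by apply: suffix_trans; rewrite -cat1s suffix_suffix.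
have [y [C [sy ys hC cov]]] := IH _ hs ch.
pose C' := [seq i :: u | i <- enum A & (i :: u \in s) && (i != h)].
exists (rcons y h), (C' ++ C); rewrite cat_rcons size_rcons; split=> //.
- move=> c; rewrite mem_cat => /orP[/mapP[i]|/hC[cs uc sc cc]].
    rewrite mem_filter => /andP[/andP[iu ih] _ ->]; split=> //=.
    + by rewrite -cat1s suffix_suffix.
    + by rewrite addnS ltnS leq_addr.
    (* A light child has at most as many nodes below it as the heavy one, and together they have
       fewer than [2 ^ k.+1]. *)
    + have half a b c' n : a + b < c' -> a <= b -> c' < 2 * n -> a < n by lia.
      by apply: half (count_children us ih) (hmax i iu) _; rewrite -expnS.
  split=> //; last by rewrite addnS -addSn.
  by apply: suffix_trans uc; rewrite -cat1s suffix_suffix.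
- move=> p ps up.
  have [->|/(child_suffix up)[i ip]] := eqVneq p u; first by apply: Or31; rewrite leq_addr.
  have [eih|nih] := eqVneq i h; last first.
    apply: Or32; exists (i :: u) => //; rewrite mem_cat map_f //.
    by rewrite mem_filter mem_enum nih (cl i p).
  rewrite eih in ip; case: (cov p ps ip) => [le|[c cC cp]|[sy' yp]].
  + by apply: Or31; rewrite addnS -addSn.
  + by apply: Or32; exists c; rewrite // mem_cat cC orbT.
  + by apply: Or33; rewrite sy'.
Qed.

End Heavy.

Section LocalMend.
Variables (A : finType) (Delta : nat) (Sigma Gamma : finType) (r : nat).
Variable psi : verifier Sigma Gamma.
Hypothesis psi_local : local_verifier Delta r psi.
Variable T : nat -> nat.
Hypotheses (mendT : verifier_mendable Delta r psi T) (oT : little_o_n T).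
Notation labeling := (labeling A Gamma).
Implicit Types (p q y z u : seq A) (lam mu alpha : labeling).

Definition label_window : finType := {ffun (2 * r).-bseq A -> option Gamma}.
Definition position_type : finType :=
  ({ffun (2 * r).-bseq A -> bool * (Sigma * bool) * bool}
    * {set label_window} * {set label_window})%type.
(** One more position than there are types, at spacing [r.+1]: two positions share a type, and the
    segment between them is longer than [r]. *)
Definition spine_length := #|position_type|.+1 * r.+1.

Variable (t : tree A Sigma).
Hypothesis wt : wf Delta t.1.
Variable lam : labeling.
Hypotheses (acc : accepted r psi t lam) (ok : holes_ok t lam).
Notation accepted := (accepted r psi t).
Notation holes_ok := (holes_ok t).

Lemma sbelow_suffix u c p : suffix u c -> sbelow c p -> sbelow u p.
Proof.
move=> uc /andP[cp ncp]; rewrite /sbelow (suffix_trans uc cp) /=.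
by apply: contra ncp => /eqP e; rewrite e in cp *; apply/eqP; apply: suffix_antisym.
Qed.

Lemma long_spine_mend u y alpha : size y = spine_length -> y ++ u \in t.1 ->
  accepted alpha -> holes_ok alpha ->
  exists mu : labeling, [/\ accepted mu, holes_ok mu,
    forall p, ~~ sbelow u p -> mu p = alpha p &
    forall p, suffix (y ++ u) p -> mu p = lam p].
Proof.
move=> sy yus accA okA.
(* [pos j] lies [j.+1 * r.+1] steps below [u]; the successor keeps even the first position strictly
   below [u] and longer than [r]. *)
pose off j := spine_length - j.+1 * r.+1.
pose pos j := drop (off j) y ++ u.
pose ty (j : 'I_#|position_type|.+1) : position_type :=
  (profile r t (pos j),
   [set w | boolp.asbool (above psi alpha u t (pos j) w)],
   [set w | boolp.asbool (above psi lam u t (pos j) w)]).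
have [i [j lt_ij ety]] : exists i : 'I_#|position_type|.+1,
    exists2 j : 'I_#|position_type|.+1, i < j & ty i = ty j.
  have /injectivePn[i [j nij e]] : ~~ injectiveb ty.
    apply/negP => /injectiveP /leq_card; by rewrite card_ord ltnn.
  by case: (ltngtP i j) nij => [lt _|lt _|/val_inj -> /eqP //]; [exists i, j|exists j, i].
have le_off a : a < #|position_type|.+1 -> a.+1 * r.+1 <= spine_length by move=> h; rewrite leq_mul2r h orbT.
have spos a : a < #|position_type|.+1 -> size (pos a) = a.+1 * r.+1 + size u.
  by move=> h; rewrite size_cat size_drop sy subKn ?le_off.
have offij : off j <= off i by rewrite leq_sub2l // leq_mul2r ltnS ltnW ?orbT.
pose y0 := take (off i - off j) (drop (off j) y).
have ej : pos j = y0 ++ pos i.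
  by rewrite /pos catA -{1}[drop (off j) y](cat_take_drop (off i - off j)) drop_drop subnK.
have sy0 : r < size y0.
  have aux a n m k : n < m -> m.+1 * r.+1 + k = a + (n.+1 * r.+1 + k) -> r < a.
    by move=> /(leq_mul (leqnn r.+1)); lia.
  by apply: (aux _ _ _ (size u) lt_ij); rewrite -!spos // ej size_cat.
have epos p : suffix (y ++ u) p -> exists z, p = z ++ y0 ++ pos i.
  case/suffixP => z ->; exists (z ++ take (off j) y).
  by rewrite -ej /pos -!catA; congr (_ ++ _); rewrite catA cat_take_drop.
have ys : y0 ++ pos i \in t.1.
  by have [z e] := epos _ (suffix_refl _); apply: (@wf_suffix _ Delta _ z _ wt); rewrite -e.
have si : r < size (pos i) by rewrite spos ?ltn_ord // mulSn; lia.
have uq : sbelow u (pos i).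
  rewrite /sbelow suffix_suffix /=; apply/eqP => /(congr1 size).
  by rewrite spos ?ltn_ord // -[RHS]add0n => /eqP; rewrite eqn_add2r.
case: ety => e1 e2 e3.
have eqab gam : gam = alpha \/ gam = lam ->
    forall w : label_window, above psi gam u t (pos i) w <-> above psi gam u t (y0 ++ pos i) w.
  rewrite -ej; case=> -> w; [move/setP: e2|move/setP: e3] => /(_ w); rewrite !inE => e;
    by split=> /boolp.asboolP h; apply/boolp.asboolP; [rewrite -e|rewrite e].
have [||mu [h1 h2 h3 h4]] := spine_mend psi_local wt _ (ltnW si) ys sy0 _ uq mendT oT
  accA okA acc ok eqab.
- by case: (pos i) si.
- by rewrite -ej.
- by exists mu; split=> // p /epos[z ->].
Qed.

(** The subtrees are treated in turn, each starting from the labeling left by the previous one. A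
    node gets its bound from the last listed subtree containing it, as later changes do not touch
    it. *)
Lemma mend_list (C : seq (seq A)) B :
  (forall c, c \in C -> forall alpha, accepted alpha -> holes_ok alpha ->
     exists mu : labeling, [/\ accepted mu, holes_ok mu,
       forall p, ~~ sbelow c p -> mu p = alpha p &
       forall p, p \in t.1 -> suffix c p -> mu p <> lam p -> size p <= B]) ->
  forall alpha, accepted alpha -> holes_ok alpha ->
  exists mu : labeling, [/\ accepted mu, holes_ok mu,
    forall p, ~~ has (fun c => sbelow c p) C -> mu p = alpha p &
    forall p, p \in t.1 -> has (fun c => suffix c p) C -> mu p <> lam p -> size p <= B].
Proof.
elim: C => [|c C IH] hC alpha accA okA; first by exists alpha.
have [mu1 [a1 o1 t1 b1]] := hC c (mem_head _ _) alpha accA okA.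
have [|mu [a2 o2 t2 b2]] := IH _ mu1 a1 o1.
  by move=> c' cC; apply: hC; rewrite inE cC orbT.
exists mu; split=> //= p; first by rewrite negb_or => /andP[np1 np2]; rewrite t2 // t1.
move=> ps; case: (boolP (has (fun c => suffix c p) C)) => [hp _|nhp]; first exact: b2.
rewrite orbF => cp; rewrite t2; first exact: b1.
by apply: contra nhp; apply: sub_has => c' /andP[].
Qed.

Lemma subtree_mend k u alpha : u \in t.1 -> count (suffix u) t.1 < 2 ^ k ->
  accepted alpha -> holes_ok alpha ->
  exists mu : labeling, [/\ accepted mu, holes_ok mu,
    forall p, ~~ sbelow u p -> mu p = alpha p &
    forall p, p \in t.1 -> suffix u p -> mu p <> lam p -> size p <= size u + k * spine_length].
Proof.
elim: k u alpha => [|k IH] u alpha us cu accA okA.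
  have : has (suffix u) t.1 by apply/hasP; exists u => //; apply: suffix_refl.
  by rewrite has_count lt0n; case: count cu.
have [y [C [sy ys hC cov]]] := heavy_path spine_length wt us cu.
have [mu0 [a0 o0 t0 b0]] : exists mu : labeling, [/\ accepted mu, holes_ok mu,
    forall p, ~~ sbelow u p -> mu p = alpha p &
    size y = spine_length -> forall p, suffix (y ++ u) p -> mu p = lam p].
  (* A path that stops early has nothing below it to restore, so [alpha] is kept. *)
  have [e|ne] := eqVneq (size y) spine_length; last by exists alpha; split=> // /eqP; rewrite (negPf ne).
  by have [mu [? ? ? ?]] := long_spine_mend e ys accA okA; exists mu.
have [|mu [a1 o1 t1 b1]] := @mend_list C (size u + k.+1 * spine_length) _ mu0 a0 o0.
  move=> c /hC[cs uc sc cc] beta accB okB.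
  have [mu [h1 h2 h3 h4]] := IH c beta cs cc accB okB.
  exists mu; split=> // p ps cp np; apply: leq_trans (h4 p ps cp np) _.
  by rewrite mulSn addnA leq_add2r.
exists mu; split=> // p.
  move=> nu; rewrite t1 ?t0 //; apply: contra nu => /hasP[c /hC[_ uc _ _]].
  exact: sbelow_suffix.
move=> ps up np; case: (cov p ps up) => [le|[c cC cp]|[ey yp]].
- by apply: leq_trans le _; rewrite leq_add2l mulSn leq_addr.
- by apply: b1 => //; apply/hasP; exists c.
- case: (boolP (has (fun c => suffix c p) C)) => [hp|nhp]; first exact: b1.
  case: np; rewrite t1 ?b0 //; apply: contra nhp; apply: sub_has => c /andP[] //.
Qed.

End LocalMend.

(** * Encoding trees by words *)

(** At the first place where two simple paths diverge, to [a] and [b], their rests connect [a] to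
    [b] while avoiding [x]; adding [x] closes a cycle. *)
Lemma uniq_path_unique (V : finType) (G : rel V) : symmetric G -> irreflexive G -> acyclic G ->
  forall x p p', path G x p -> path G x p' -> uniq (x :: p) -> uniq (x :: p') ->
    last x p = last x p' -> p = p'.
Proof.
move=> sym irr acyc x p; elim: p x => [|a p IH] x [|b p'] //.
- by move=> _ _ _ /andP[+ _] /= e; rewrite {1}e mem_last.
- by move=> _ _ /andP[+ _] _ /= e; rewrite -{1}e mem_last.
move=> pa pb ua ub /= elast.
have [eab|nab] := eqVneq a b.
  move: pa pb ua ub; rewrite -eab => /andP[_ pa] /andP[_ pb] /andP[_ ua] /andP[_ ub].
  by congr cons; apply: (IH a) => //; rewrite elast eab.
(* The graph with the node [x] deleted. *)
pose e := [rel u w | [&& G u w, u != x & w != x]].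
have eP c q : path G c q -> x \notin c :: q -> connect e c (last c q).
  elim: q c => [|d q IHq] c /=; first by rewrite connect0.
  rewrite !inE !negb_or => /andP[Gcd pq] /and3P[xc xd xq].
  apply: connect_trans (connect1 _) (IHq d pq _); last by rewrite inE negb_or xd.
  by rewrite /= Gcd eq_sym xc eq_sym xd.
have esym : symmetric e by move=> u w; rewrite /= sym; congr (_ && _); apply: andbC.
have : connect e a b.
  move: pa pb ua ub => /andP[_ pa] /andP[_ pb] /andP[xa _] /andP[xb _].
  apply: connect_trans (eP _ _ pa xa) _.
  by rewrite elast (sym_connect_sym esym); apply: eP.
case/connectP => q0 pq0 eb; case: (shortenP pq0) eb => q pq uq _ eb.
have Gxa : G x a by case/andP: pa.
have Gbx : G b x by rewrite sym; case/andP: pb.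
have [pGq xq] : path G a q /\ x \notin a :: q.
  have : x != a by apply/eqP => exa; rewrite exa irr in Gxa.
  elim: (q) (a) pq => [|d q' IHq] c /= h xc; first by rewrite inE.
  case/andP: h => /and3P[Gcd _ dx] /IHq; rewrite eq_sym => /(_ dx) [-> h2].
  by rewrite Gcd inE negb_or xc.
have := acyc [:: x, a & q]; rewrite /cycle [uniq _]/= -/(uniq (a :: q)) xq => /(_ uq).
rewrite rcons_path /= -eb Gxa pGq Gbx => h; exfalso.
by move: h; case: (q) eb nab => [/= ->|d q' _ _]; [rewrite eqxx | move=> /(_ isT)].
Qed.

(** The address of a node is the reversed list of port numbers along the unique simple path from
    [v], so that ancestors become suffixes. *)
Lemma encode_tree (Delta : nat) (V : finType) (G : rel V) (v : V) : in_tree_family Delta G ->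
  exists addr : V -> seq 'I_Delta.+1,
    [/\ injective addr, addr v = [::], forall x y, adj (addr x) (addr y) = G x y &
        wf Delta (map addr (enum V))].
Proof.
case=> sym irr conn acyc deg.
pose P y p := [&& path G v p, uniq (v :: p) & last v p == y].
have exP y : exists p, P y p.
  have [p0 pp0 ->] := connectP (conn v y); case: (shortenP pp0) => p pp up _.
  by exists p; rewrite /P pp up eqxx.
pose pth y := xchoose (exP y).
have pthP y : P y (pth y) by apply: xchooseP.
have pthU y p : P y p -> pth y = p.
  case/and3P: (pthP y) => p1 u1 /eqP e1 /and3P[p2 u2 /eqP e2].
  by apply: (uniq_path_unique sym irr acyc p1 p2 u1 u2); rewrite e1 e2.
have pth_adj x y : G x y -> pth y = rcons (pth x) y \/ pth x = rcons (pth y) x.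
  move=> Gxy; case/and3P: (pthP x) => px ux /eqP ex.
  (* If [y] is not on the path to [x], the path extends to [y]; otherwise its initial part up to
     [y], followed by [x], is the path to [x]. *)
  case: (boolP (y \in v :: pth x)) => [yp|ny]; [right|left]; last first.
    apply: pthU; rewrite /P rcons_path px ex Gxy last_rcons eqxx -rcons_cons rcons_uniq ny.
    by rewrite ux.
  case/splitPl: yp px ux ex => p1 p2 ey; rewrite cat_path last_cat ey => /andP[p1P p2P] up ex.
  have p2N : p2 != [::] by apply/eqP => p20; move: ex Gxy; rewrite p20 /= => ->; rewrite irr.
  have up1 : uniq (v :: p1) by move: up; rewrite -cat_cons cat_uniq => /andP[].
  have -> : pth y = p1 by apply: pthU; rewrite /P p1P up1 ey eqxx.
  rewrite -(pthU x (p1 ++ p2)); last first.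
    by rewrite /P cat_path p1P ey p2P up last_cat ey ex eqxx.
  apply: pthU; rewrite /P rcons_path p1P ey sym Gxy last_rcons eqxx andbT -rcons_cons rcons_uniq up1.
  rewrite !andbT andTb; move: up; rewrite -cat_cons cat_uniq => /and3P[_ /hasPn h _].
  by apply: h; rewrite -ex; case: (p2) p2N => // c p3 _; rewrite /= mem_last.
(* The alphabet has [Delta.+1] letters so that it is inhabited for [Delta = 0] too, as [inord]
   requires. *)
pose port a b : 'I_Delta.+1 := inord (index b (enum [set z | G a z])).
have port_inj a b c : G a b -> G a c -> port a b = port a c -> b = c.
  have mem d : G a d -> d \in enum [set z | G a z] by rewrite mem_enum inE.
  have bnd d : G a d -> index d (enum [set z | G a z]) < Delta.+1.
    move=> /mem; rewrite -index_mem -cardE => lt.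
    by rewrite ltnS ltnW // (leq_trans lt).
  move=> Gb Gc /(congr1 val); rewrite /= !inordK ?bnd // => e.
  by rewrite -(nth_index b (mem b Gb)) e nth_index ?mem.
have ports_inj x p p' : path G x p -> path G x p' ->
    pairmap port x p = pairmap port x p' -> p = p'.
  elim: p x p' => [|a p IH] x [|b p'] //= /andP[Ga pa] /andP[Gb pb] [e1 e2].
  have eab := port_inj _ _ _ Ga Gb e1; rewrite -eab in pb e2 *.
  by rewrite (IH _ _ pa pb e2).
pose addr y := rev (pairmap port v (pth y)).
have addr_rcons p y : rev (pairmap port v (rcons p y)) = port (last v p) y :: rev (pairmap port v p).
  by rewrite -cats1 pairmap_cat rev_cat.
have addr_inj : injective addr.
  move=> x y /(can_inj revK) e.
  case/and3P: (pthP x) => px _ /eqP <-; case/and3P: (pthP y) => py _ /eqP <-.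
  by rewrite (ports_inj _ _ _ px py e).
have addr_v : addr v = [::] by rewrite /addr (pthU v [::]) // /P /= eqxx.
have addr_cons y i q : addr y = i :: q -> exists x, [/\ q = addr x, G x y & i = port x y].
  rewrite /addr; case/and3P: (pthP y); case/lastP: (pth y) => // p z.
  rewrite rcons_path last_rcons -rcons_cons rcons_uniq => /andP[pp Gz] /andP[_ up] /eqP ezy.
  rewrite -ezy addr_rcons => -[<- <-]; exists (last v p); split=> //.
  by rewrite (pthU _ p) // /P pp up eqxx.
have addr_step x y : pth y = rcons (pth x) y -> addr y = port x y :: addr x.
  move=> e; rewrite /addr e addr_rcons; congr (port _ _ :: _).
  by case/and3P: (pthP x) => _ _ /eqP.
have adjE x y : adj (addr x) (addr y) = G x y.
  apply/adjP/idP => [[i [/addr_cons|/addr_cons]]|/pth_adj[/addr_step ->|/addr_step ->]].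
  - by case=> z [/addr_inj ->].
  - by case=> z [/addr_inj ->]; rewrite sym.
  - by exists (port x y); left.
  - by exists (port y x); right.
exists addr; split=> //; split.
- by rewrite -addr_v map_f ?mem_enum.
- move=> i p /mapP[y _ /esym/addr_cons[x [-> _ _]]]; exact: map_f (mem_enum _ _).
- move=> p /mapP[x _ ->]; apply: leq_trans (deg x).
  pose N := [set y | G x y].
  (* The neighbors with longer addresses are the children; for a node other than [v], the parent is
     one more neighbor. *)
  pose N1 := [set y in N | size (addr x) < size (addr y)].
  have subN : N1 \subset N by apply/subsetP => y; rewrite inE => /andP[].
  apply: (@leq_trans ((addr x != [::]) + #|N1|)).
    rewrite leq_add2l; apply: leq_trans (leq_imset_card (port x) N1).
    apply: subset_leq_card; apply/subsetP => i; rewrite inE => /mapP[y _ /esym e].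
    have [z [/addr_inj <- Gxy ->]] := addr_cons _ _ _ e.
    by apply: imset_f; rewrite !inE Gxy e /=.
  case ex : (addr x) => [|j q] /=; first exact: subset_leq_card.
  have [z [ez Gzx _]] := addr_cons _ _ _ ex.
  rewrite add1n; apply: proper_card; apply/properP; split=> //.
  by exists z; rewrite !inE ?[G x z]sym ?Gzx // ex -ez /= ltnNge leqnSn.
Qed.

Section Transfer.
Variables (Delta : nat) (Sigma Gamma : finType) (r : nat) (psi : verifier Sigma Gamma).
Hypothesis psi_local : local_verifier Delta r psi.
Variables (V : finType) (G : rel V) (sigma : V -> Sigma) (v : V) (A : finType).
Variable addr : V -> seq A.
Hypotheses (fG : in_tree_family Delta G) (addr_inj : injective addr) (addr_v : addr v = [::]).
Hypothesis adjE : forall x y, adj (addr x) (addr y) = G x y.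
Let s := map addr (enum V).
Hypothesis ws : wf Delta s.
Variable info : seq A -> Sigma * bool.
Hypothesis infoE : forall x, (info (addr x)).1 = sigma x.

Lemma addr_mem x : addr x \in s. Proof. by rewrite map_f ?mem_enum. Qed.

Lemma addr_surj (y : seq_sub s) : exists x, val y = addr x.
Proof. by have /mapP[x _ e] := valP y; exists x. Qed.

Lemma accepted_addr (lam : labeling A Gamma) :
  accepted r psi (s, info) lam <-> relaxed_accepts r psi G sigma (lam \o addr).
Proof.
split=> [acc x|acc p y ey].
  apply: (relaxed_happy_iso psi_local (wf_tree ws) fG) (acc _ (SeqSub (addr_mem x)) erefl).
  apply: (@ball_iso_of_rel _ _ _ _ _ _ _ _ _ _ _ _ _ (fun y x => val y == addr x)) => //.
  - by move=> y z z' /eqP -> /eqP /addr_inj.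
  - by move=> y y' z /eqP e /eqP e'; apply: val_inj; rewrite e e'.
  - by move=> y z y' z' /eqP e /eqP e'; rewrite /tgraph e e' adjE.
  - by move=> t y z y' _ _ _ _; have [z' ->] := addr_surj y'; exists z'.
  - by move=> t y z z' _ _ _ _; exists (SeqSub (addr_mem z')).
  - by move=> y z _ /eqP /= ->; rewrite infoE.
have [x ex] := addr_surj y.
apply: (relaxed_happy_iso psi_local fG (wf_tree ws)) (acc x).
apply: (@ball_iso_of_rel _ _ _ _ _ _ _ _ _ _ _ _ _ (fun x y => val y == addr x)) => //.
- by move=> z y1 y2 /eqP e /eqP e'; apply: val_inj; rewrite e e'.
- by move=> z z' y1 /eqP -> /eqP /addr_inj.
- exact/eqP.
- by move=> z y1 z' y1' /eqP e /eqP e'; rewrite /tgraph e e' adjE.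
- by move=> t y1 z z' _ _ _ _; exists (SeqSub (addr_mem z')).
- by move=> t y1 z y' _ _ _ _; have [z' ->] := addr_surj y'; exists z'.
- by move=> z y1 _ /eqP /= ->; rewrite infoE.
Qed.

Lemma addr_ball t x : size (addr x) <= t -> x \in ball G t v.
Proof.
elim: t x => [|t IH] x.
  by rewrite leqn0 size_eq0 -addr_v => /eqP/addr_inj ->; apply: ball_center.
case ex : (addr x) => [|i q] le.
  by move: ex; rewrite -addr_v => /addr_inj ->; apply: ball_center.
have : q \in s by case: ws => _ cl _; apply: (cl i); rewrite -ex addr_mem.
case/mapP => y _ ey; apply: (@ball_step _ _ _ _ y); first by apply: IH; rewrite -ey.
by rewrite -adjE ex -ey; apply/adjP; exists i; left.
Qed.

End Transfer.

(** * The logarithmic mending radius *)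

Lemma log_mendable (Delta : nat) (Sigma Gamma : finType) (r : nat) (psi : verifier Sigma Gamma)
    (T : nat -> nat) :
  local_verifier Delta r psi -> verifier_mendable Delta r psi T -> little_o_n T ->
  verifier_mendable Delta r psi
    (fun n => (trunc_log 2 n).+1 * spine_length 'I_Delta.+1 Sigma Gamma r).
Proof.
move=> psi_local mendT oT V G sigma lam fG accV v.
have [addr [addr_inj addr_v adjE ws]] := encode_tree v fG.
set s := map addr (enum V) in ws.
pose dec (p : seq 'I_Delta.+1) := [pick x | addr x == p].
have decE x : dec (addr x) = Some x.
  rewrite /dec; case: pickP => [y /eqP/addr_inj -> //|/(_ x)].
  by rewrite eqxx.
pose lamW p := if dec p is Some x then lam x else None.
(* Exactly the holes of [lam] are permitted at nodes, so [holes_ok] says that no hole has been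
   created. *)
pose info p := if dec p is Some x then (sigma x, lam x == None) else (sigma v, true).
have lamWE x : lamW (addr x) = lam x by rewrite /lamW decE.
have infoE x : (info (addr x)).1 = sigma x by rewrite /info decE.
have transfer := accepted_addr psi_local fG addr_inj adjE ws infoE.
have accW : accepted r psi (s, info) lamW.
  by apply/transfer => x; apply: relaxed_happy_ext (accV x) => y _; rewrite /= lamWE.
have okW mu : (forall p, mu p = None -> lamW p = None) -> holes_ok (Gamma := Gamma) (s, info) mu.
  by move=> h p /mapP[x _ ->] /h; rewrite lamWE /= /info decE => ->.
have root : [::] \in s by case: ws.
(* The [o(n)]-mend [alpha] fills the root; its changes beyond logarithmic depth are then undone by
   [subtree_mend]. *)
have [alpha [accA rootA holeA _]] := mend_words (st := (s, info)) mendT ws accW root.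
have [|mu [accM okM topM farM]] := subtree_mend (t := (s, info)) psi_local mendT oT (k := (trunc_log 2 #|V|).+1)
  ws accW (okW lamW (fun _ => id)) root _ accA (okW _ holeA).
  apply: leq_ltn_trans (count_size _ _) _.
  by rewrite size_map -cardE trunc_log_ltn.
exists (mu \o addr); split.
- exact/transfer.
- by rewrite /= addr_v topM // /sbelow eqxx andbF.
- move=> x /= hx; have := okM (addr x) (addr_mem _ x) hx.
  by rewrite /= /info decE /= => /eqP.
- move=> x ne; apply: (addr_ball addr_inj addr_v adjE ws).
  apply: (farM _ (addr_mem _ x)); first by rewrite suffix0s.
  by rewrite lamWE.
Qed.

Theorem theorem8p5 (Delta : nat) (Sigma Gamma : finType) (r0 : nat)
  (psi0 : verifier Sigma Gamma) :
  local_verifier Delta r0 psi0 ->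
  forall T : nat -> nat, little_o_n T -> problem_mendable Delta psi0 T ->
  exists T' : nat -> nat, big_O_log T' /\ problem_mendable Delta psi0 T'.
Proof.
move=> _ T oT [r [psi [psi_local same mendT]]].
exists (fun n => (trunc_log 2 n).+1 * spine_length 'I_Delta.+1 Sigma Gamma r); split.
  (* For [2 <= n] the logarithm is at least 1, so its successor is at most twice as large. *)
  exists (2 * spine_length 'I_Delta.+1 Sigma Gamma r), 2 => n n2.
  have : 0 < trunc_log 2 n by rewrite trunc_log_gt0.
  by nia.
by exists r, psi; split=> //; apply: log_mendable psi_local mendT oT.
Qed.
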